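(* Consider the stochastic Poisson system in $\mathbb{R}^d$ $$dy(t)=B(y(t))\Big(\nabla H_0(y(t))\,dt+\sum_{r=1}^m\nabla H_r(y(t))\circ dW_r(t)\Big),$$ and suppose the structure matrix is constant, $B(y)\equiv B$. Then the diagonal implicit Runge-Kutta methods preserve the Casimir functions: for every Casimir function $C$ of the system, every numerical solution $\{y_k\}$ produced by a diagonal implicit Runge-Kutta method satisfies $C(y_{k+1})=C(y_k)$ for all $k$, almost surely.
   Context: $H_0,\dots,H_m:\mathbb{R}^d\to\mathbb{R}$ are smooth; $B\in\mathbb{R}^{d\times d}$ is a constant skew-symmetric matrix; $W=(W_1,\dots,W_m)$ is an $m$-dimensional standard Wiener process; $\circ$ is the Stratonovich product. A differentiable function $C:\mathbb{R}^d\to\mathbb{R}$ is a Casimir function of the system if $\nabla C(y)^\top B=0$ for all $y\in\mathbb{R}^d$. Diagonal implicit Runge-Kutta method with $s$ stages: given real weights $b_i^l$ ($i=1,\dots,s$, $l=0,\dots,m$) with $\sum_{i=1}^s b_i^l=1$ for each $l$, set $a_{ij}^l=b_j^l$ if $i>j$, $a_{ii}^l=\frac12 b_i^l$, $a_{ij}^l=0$ if $i<j$. With $f_l(y)=B\nabla H_l(y)$, time step $h>0$ and increments $J_k^r=W_r(t_{k+1})-W_r(t_k)$, the step $y_k\mapsto y_{k+1}$ is $$Y_i=y_k+h\sum_{j=1}^sa_{ij}^0f_0(Y_j)+\sum_{r=1}^m\sum_{j=1}^sa_{ij}^rf_r(Y_j)J_k^r,\quad i=1,\dots,s,$$ $$y_{k+1}=y_k+h\sum_{i=1}^sb_i^0f_0(Y_i)+\sum_{r=1}^m\sum_{i=1}^sb_i^rf_r(Y_i)J_k^r.$$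 A numerical solution is any sequence $\{y_k\}$, with stages $Y_i$ at each step, satisfying these equations (pathwise). *)

(* Defs.v *)
From HB Require Import structures.
From mathcomp Require Import all_boot all_order all_algebra.
From mathcomp Require Import all_classical all_reals all_analysis.

Set Implicit Arguments.
Unset Strict Implicit.
Unset Printing Implicit Defensive.
Import Order.TTheory GRing.Theory Num.Theory.
Import numFieldNormedType.Exports.
Local Open Scope classical_set_scope.
Local Open Scope ring_scope.

Section Calculus.
Context {R : realType} {d : nat}.
Implicit Types (f : 'cV[R]_d -> R) (y : 'cV[R]_d).

Definition basis_vec (i : 'I_d) : 'cV[R]_d := delta_mx i 0.

Definition grad f y : 'cV[R]_d := \col_(i < d) 'D_(basis_vec i) f y.

Definition iter_partial f (s : seq 'I_d) : 'cV[R]_d -> R :=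
  foldr (fun i g y => 'D_(basis_vec i) g y) f s.

(* C^infinity: all iterated partial derivatives exist and are continuous *)
Definition smooth f : Prop :=
  forall s : seq 'I_d,
    continuous (iter_partial f s) /\
    forall i y, derivable (iter_partial f s) y (basis_vec i).

End Calculus.

Section Wiener.
Context {d : measure_display} {T : measurableType d} {R : realType}.
Variable P : probability T R.

(* Some of the A i may be setT, so the product rule for every subfamily is
   included. *)
Definition mutually_independent (I : finType) (X : I -> T -> R) : Prop :=
  forall A : I -> set R, (forall i, measurable (A i)) ->
    P (\bigcap_(i in [set: I]) (X i @^-1` A i)) =
    (\prod_(i : I) P (X i @^-1` A i))%E.

(* Times range over t >= 0; the values of W at negative times are irrelevant.
   The third clause states at once that the m coordinates are independent of
   each other and that each has independent increments. The second argument of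
   normal_prob is the standard deviation. *)
Definition standard_wiener (m : nat) (W : 'I_m -> R -> {RV P >-> R}) : Prop :=
  [/\ forall r, {ae P, forall w, W r 0 w = 0},
      forall r (u v : R), 0 <= u -> u < v ->
        forall A : set R, measurable A ->
          P ((fun w => W r v w - W r u w) @^-1` A) =
          normal_prob 0 (Num.sqrt (v - u)) A,
      forall (n : nat) (t : nat -> R),
        0 <= t 0%N -> {homo t : i j / (i < j)%N >-> i < j} ->
        mutually_independent
          (fun (p : 'I_m * 'I_n) w => W p.1 (t p.2.+1) w - W p.1 (t p.2) w)
    & forall r, {ae P, forall w,
        {within `[0, +oo[, continuous (fun t : R => W r t w)}}].

End Wiener.

Section PoissonSystem.
Context {R : realType} {d : nat}.
Implicit Types (B : 'M[R]_d) (C : 'cV[R]_d -> R).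

Definition casimir B C : Prop :=
  (forall y, differentiable C y) /\ forall y, (grad C y)^T *m B = 0.

(* Index ord0 is the drift Hamiltonian H_0; lift ord0 r is the Hamiltonian of
   the r-th noise. *)
Definition poisson_field m B (H : 'I_m.+1 -> 'cV[R]_d -> R) (l : 'I_m.+1)
    (y : 'cV[R]_d) : 'cV[R]_d :=
  B *m grad (H l) y.

End PoissonSystem.

Section RungeKutta.
Context {R : realType} {d m s : nat}.
Local Notation V := 'cV[R]_d.

Definition rk_step (f : 'I_m.+1 -> V -> V)
    (a : 'I_m.+1 -> 'I_s -> 'I_s -> R) (b : 'I_m.+1 -> 'I_s -> R)
    (h : R) (J : 'I_m -> R) (y : V) (Y : 'I_s -> V) (y' : V) : Prop :=
  (forall i, Y i = y + h *: (\sum_j a ord0 i j *: f ord0 (Y j))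
       + \sum_r \sum_j (a (lift ord0 r) i j * J r) *: f (lift ord0 r) (Y j))
  /\ y' = y + h *: (\sum_i b ord0 i *: f ord0 (Y i))
       + \sum_r \sum_i (b (lift ord0 r) i * J r) *: f (lift ord0 r) (Y i).

Definition dirk_weights (b : 'I_m.+1 -> 'I_s -> R) : Prop :=
  forall l, \sum_i b l i = 1.

Definition dirk_coef (b : 'I_m.+1 -> 'I_s -> R) (l : 'I_m.+1) (i j : 'I_s) : R :=
  if (j < i)%N then b l j else if i == j then b l i / 2 else 0.

Definition grid (t0 h : R) (k : nat) : R := t0 + k%:R * h.

(* Here W is a single path of the driving process. *)
Definition dirk_solution (B : 'M[R]_d) (H : 'I_m.+1 -> V -> R)
    (b : 'I_m.+1 -> 'I_s -> R) (t0 h : R) (W : 'I_m -> R -> R)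
    (y : nat -> V) (Y : nat -> 'I_s -> V) : Prop :=
  forall k, rk_step (poisson_field B H) (dirk_coef b) b h
    (fun r => W r (grid t0 h k.+1) - W r (grid t0 h k))
    (y k) (Y k) (y k.+1).

End RungeKutta.

(* Main.v *)
(** The increment of a Runge-Kutta step is a linear combination of values of the
fields [B grad H_l], hence of the form [B v].  Along the segment from [y_k] to
[y_k + B v] the derivative of a Casimir [C] is [grad C^T B v = 0], so [C] is
constant on it. *)

Require Import Defs.
From HB Require Import structures.
From mathcomp Require Import all_boot all_order all_algebra.
From mathcomp Require Import all_classical all_reals all_analysis.

Set Implicit Arguments.
Unset Strict Implicit.
Unset Printing Implicit Defensive.
Import Order.TTheory GRing.Theory Num.Theory.
Import numFieldNormedType.Exports.
Local Open Scope classical_set_scope.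
Local Open Scope ring_scope.

Section Gradient.
Context {R : realType} {d : nat}.
Implicit Types (C : 'cV[R]_d -> R) (x u v : 'cV[R]_d).

(** Differentiability makes the directional derivative linear in its direction, so it can be
    computed by expanding [v] in the standard basis. *)
Lemma derive_grad C x v :
  differentiable C x -> 'D_v C x = ((grad C x)^T *m v) 0 0.
Proof.
move=> dC; have v_sum : v = \sum_i v i 0 *: basis_vec i.
  rewrite [LHS]matrix_sum_delta; apply: eq_bigr => i _.
  by rewrite big_ord1.
rewrite deriveE // mxE [in LHS]v_sum linear_sum; apply: eq_bigr => i _.
by rewrite linearZ /= !mxE deriveE // mulrC.
Qed.

(** Both derivatives are limits of the same difference quotient, so no chain rule is invoked. *)
Lemma is_derive_along_line C x u (t : R) (l : R) :
  is_derive (x + t *: u) u C l -> is_derive t 1 (fun r : R => C (x + r *: u)) l.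
Proof.
have line (r : R) : x + (r *: 1 + t) *: u = r *: u + (x + t *: u).
  by rewrite [r *: 1]mulr1 scalerDl addrCA.
have quotE : (fun r : R => r^-1 *: (C (x + (r *: 1 + t) *: u) - C (x + t *: u)))
    = (fun r : R => r^-1 *: (C (r *: u + (x + t *: u)) - C (x + t *: u))).
  by apply/funext => r; rewrite line.
case=> dC <-; split.
  by rewrite /derivable /= quotE.
by rewrite /derive /= quotE.
Qed.

End Gradient.

Lemma casimir_shift (R : realType) (d : nat) (B : 'M[R]_d) (C : 'cV[R]_d -> R)
  (x v : 'cV[R]_d) : casimir B C -> C (x + B *m v) = C x.
Proof.
move=> [dC gradC0]; set u := B *m v.
(* Since [B] is constant, the fixed direction [u] lies in the image of the structure matrix at every
   point of the line. *)
have phi' (t : R) : is_derive t 1 (fun r : R => C (x + r *: u)) 0.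
  apply: is_derive_along_line; split; first exact: diff_derivable.
  by rewrite derive_grad // mulmxA gradC0 mul0mx mxE.
(* The parameters 1 and 0 give the end points [x + u] and [x]. *)
by have := is_derive_0_is_cst 1 0 phi'; rewrite /= scale1r scale0r addr0.
Qed.

Lemma rk_step_poisson_shift (R : realType) (d m s : nat) (B : 'M[R]_d)
  (H : 'I_m.+1 -> 'cV[R]_d -> R) (a : 'I_m.+1 -> 'I_s -> 'I_s -> R)
  (b : 'I_m.+1 -> 'I_s -> R) (h : R) (J : 'I_m -> R) (y y' : 'cV[R]_d)
  (Y : 'I_s -> 'cV[R]_d) :
  rk_step (poisson_field B H) a b h J y Y y' -> exists v, y' = y + B *m v.
Proof.
case=> _ ->.
(* The witness is the increment of the step with the common left factor [B] pulled out. *)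
exists (h *: (\sum_i b ord0 i *: grad (H ord0) (Y i))
  + \sum_r \sum_i (b (lift ord0 r) i * J r) *: grad (H (lift ord0 r)) (Y i)).
rewrite mulmxDr -scalemxAr !mulmx_sumr addrA; congr (_ + _ *: _ + _).
  by apply: eq_bigr => i _; rewrite -scalemxAr.
apply: eq_bigr => r _; rewrite mulmx_sumr.
by apply: eq_bigr => i _; rewrite -scalemxAr.
Qed.

Theorem theorem4p2 (R : realType) (disp : measure_display)
  (T : measurableType disp) (P : probability T R) (d m s : nat)
  (B : 'M[R]_d) (H : 'I_m.+1 -> 'cV[R]_d -> R)
  (W : 'I_m -> R -> {RV P >-> R})
  (B_skew : B^T = - B)
  (H_smooth : forall l, smooth (H l))
  (W_wiener : standard_wiener W)
  (b : 'I_m.+1 -> 'I_s -> R) (b_weights : dirk_weights b)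
  (t0 h : R) (t0_ge0 : 0 <= t0) (h_gt0 : 0 < h)
  (C : 'cV[R]_d -> R) (C_casimir : casimir B C)
  (y : nat -> T -> 'cV[R]_d) (Y : nat -> 'I_s -> T -> 'cV[R]_d)
  (y_sol : {ae P, forall w, dirk_solution B H b t0 h (fun r t => W r t w)
                              (fun k => y k w) (fun k i => Y k i w)}) :
  {ae P, forall w, forall k, C (y k.+1 w) = C (y k w)}.
Proof.
(* The argument is pathwise: one null set, off which the scheme holds, serves all [k]. *)
apply: filterS y_sol => w sol k.
by have [v ->] := rk_step_poisson_shift (sol k); exact: casimir_shift.
Qed.
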